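(* Let $X$ and $Y$ be Cantor spaces. Then the set $\mathcal{C}_{iso}(X,Y)$ of homeomorphisms from $X$ onto $Y$ is a $G_\delta$ subset of the completely metrizable space $\mathcal{C}(X,Y)$ of continuous maps from $X$ to $Y$, the set $\mathcal{C}_{sur}(X,Y)$ of surjective continuous maps is closed in $\mathcal{C}(X,Y)$, and $\mathcal{C}_{iso}(X,Y)$ is dense in $\mathcal{C}_{sur}(X,Y)$. Thus the generic surjective continuous map from $X$ to $Y$ is invertible, i.e. $\mathcal{C}_{iso}(X,Y)$ is residual in $\mathcal{C}_{sur}(X,Y)$.
   Context: A Cantor space is a (nonempty) compact, metrizable, zero-dimensional topological space (clopen sets form a basis) with no isolated points. For compact metrizable $X,Y$, $\mathcal{C}(X,Y)$ is the set of continuous maps $X\to Y$ with the topology of uniform convergence, given by the sup metric $d(T_1,T_2)=\sup_{x\in X} d(T_1(x),T_2(x))$ for a metric $d$ on $Y$. $\mathcal{C}_{sur}(X,Y)$ and $\mathcal{C}_{iso}(X,Y)$ are the subsets of surjective and of bijective continuous maps (the latter are homeomorphisms by compactness). A subset of a completely metrizable space is residual when it contains a dense $G_\delta$ subset; its members are then called generic. *)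

(* Defs.v *)
From HB Require Import structures.
From mathcomp Require Import all_boot all_order all_algebra.
From mathcomp Require Import all_classical all_reals all_analysis.
From mathcomp Require Import borel_hierarchy lra.
Set Implicit Arguments.
Unset Strict Implicit.
Unset Printing Implicit Defensive.
Import Order.TTheory GRing.Theory Num.Theory.
Import numFieldTopology.Exports.
Local Open Scope classical_set_scope.
Local Open Scope ring_scope.

Section metrizability.
Context {R : realType} {T : topologicalType}.

Definition is_metric (d : T -> T -> R) : Prop :=
  [/\ forall x y, 0 <= d x y,
      forall x y, d x y = 0 <-> x = y,
      forall x y, d x y = d y x &
      forall x y z, d x z <= d x y + d y z].

Definition induces_topology (d : T -> T -> R) : Prop :=
  forall x : T,
    nbhs x = filter_from [set e : R | 0 < e] (fun e => [set y | d x y < e]).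

Definition complete_for (d : T -> T -> R) : Prop :=
  forall u : nat -> T,
    (forall e : R, 0 < e ->
      exists N, forall m n, (N <= m)%N -> (N <= n)%N -> d (u m) (u n) < e) ->
    exists l : T, u @ \oo --> l.

End metrizability.

Definition metrizable (R : realType) (T : topologicalType) : Prop :=
  exists d : T -> T -> R, is_metric d /\ induces_topology d.

Definition completely_metrizable (R : realType) (T : topologicalType) : Prop :=
  exists d : T -> T -> R,
    [/\ is_metric d, induces_topology d & complete_for d].

(* The library's [cantor_like] does not ask for metrizability and its
   [zero_dimensional] only asks that clopen sets separate points. *)
Definition is_cantor (R : realType) (T : topologicalType) : Prop :=
  [/\ [set: T] !=set0,
      compact [set: T],
      metrizable R T,
      basis (@clopen T) &
      isolated [set: T] = set0].

Definition residual (T : topologicalType) (S : set T) : Prop :=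
  exists G : set T, [/\ Gdelta G, dense G & G `<=` S].

(* [continuousType X Y] with the uniformity of uniform convergence; an alias
   because the library leaves the topology on this type to a local import. *)
Definition cfun (X : topologicalType) (Y : uniformType) : Type :=
  continuousType X Y.

Definition cfun_val (X : topologicalType) (Y : uniformType) (f : cfun X Y) :
  arrow_uniform_type X Y := (f : continuousType X Y).
Coercion cfun_val : cfun >-> arrow_uniform_type.

HB.instance Definition _ (X : topologicalType) (Y : uniformType) :=
  Choice.copy (cfun X Y) (continuousType X Y).
HB.instance Definition _ (X : topologicalType) (Y : uniformType) :=
  Uniform.copy (cfun X Y) (initial_topology (@cfun_val X Y)).
HB.instance Definition _ (X : topologicalType) (R : realType)
    (Y : pseudoMetricType R) :=
  PseudoMetric.copy (cfun X Y) (initial_topology (@cfun_val X Y)).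

Section sup_metric.
Context {R : realType} {X : topologicalType} {Y : metricType R}.
Context (X0 : [set: X] !=set0) (cptX : compact [set: X]).

Definition supdist (f g : cfun X Y) : R :=
  sup [set mdist (f x) (g x) | x in [set: X]].

Lemma cfun_continuous (f : cfun X Y) : continuous f.
Proof. exact: (@cts_fun _ _ (f : continuousType X Y)). Qed.

Lemma supdist_has_sup (f g : cfun X Y) :
  has_sup [set mdist (f x) (g x) | x in [set: X]].
Proof.
split; first by have [x _] := X0; exists (mdist (f x) (g x)); exists x.
have : \forall M \near +oo,
    [set: X] `<=` (fun x => mdist (f x) (g x) <= M).
  apply: (iffLR (compact_near_coveringP _) cptX) => x _.
  near=> y M; rewrite /=.
  have fy : mdist (f x) (f y) < 1.
    near: y; have := @cfun_continuous f x (ball (f x) 1).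
    by rewrite ballEmdist; apply; rewrite -ballEmdist; exact: nbhsx_ballx.
  have gy : mdist (g x) (g y) < 1.
    near: y; have := @cfun_continuous g x (ball (g x) 1).
    by rewrite ballEmdist; apply; rewrite -ballEmdist; exact: nbhsx_ballx.
  have M2 : mdist (f x) (g x) + 2 <= M.
    by near: M; apply: nbhs_pinfty_ge; rewrite num_real.
  have := metric_triangle (f y) (f x) (g y).
  have := metric_triangle (f x) (g x) (g y).
  by rewrite (metric_sym (f y) (f x)) /=; lra.
case=> M [_ /(_ (M + 1))]; rewrite ltrDl ltr01 => /(_ isT) XM.
by exists (M + 1) => _ [x _ <-]; exact: XM.
Unshelve. all: by end_near. Qed.

Lemma supdist_ub (f g : cfun X Y) x : mdist (f x) (g x) <= supdist f g.
Proof. by apply: ub_le_sup; [case: (supdist_has_sup f g)|exists x]. Qed.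

Lemma supdist_le (f g : cfun X Y) e :
  (forall x, mdist (f x) (g x) <= e) -> supdist f g <= e.
Proof.
move=> fge; apply: ge_sup; first by case: (supdist_has_sup f g).
by move=> _ [x _ <-].
Qed.

Lemma supdist_is_metric : is_metric supdist.
Proof.
have [x0 _] := X0.
split=> [f g|f g|f g|f g h].
- exact: le_trans (mdist_ge0 _ _) (supdist_ub f g x0).
- split=> [fg0|->].
    apply/(@continuousEP X Y) => x; apply: (@mdist_positivity R).
    by apply/eqP; rewrite eq_le mdist_ge0 andbT -fg0; exact: supdist_ub.
  apply/eqP; rewrite eq_le supdist_le/= => [|x]; last by rewrite mdistxx.
  exact: le_trans (mdist_ge0 _ _) (supdist_ub g g x0).
- by congr sup; apply/seteqP; split=> _ [x _ <-]; exists x => //;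
    rewrite metric_sym.
- apply: supdist_le => x; apply: le_trans (metric_triangle _ (g x) _) _.
  by apply: lerD; exact: supdist_ub.
Qed.

Lemma supdist_induces : induces_topology supdist.
Proof.
move=> f; rewrite -(@filter_from_ballE R); apply/seteqP; split=> P [e e0 eP].
  exists e => // g /= fge; apply: eP; have gx x : ball (f x) e (g x); last exact: gx.
  rewrite ballEmdist /=.
  exact: le_lt_trans (supdist_ub f g x) fge.
exists (e / 2); rewrite /= ?divr_gt0// => g fge; apply: eP => /=.
have e2 : e / 2 < e by rewrite ltr_pdivrMr// ltr_pMr// ltr1n.
apply: le_lt_trans e2; apply: supdist_le => x.
have : ball (f x) (e / 2) (g x) by exact: fge.
by rewrite ballEmdist => /ltW.
Qed.
End sup_metric.

Section surjective_and_bijective_maps.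
Variables (X : topologicalType) (Y : uniformType).

Definition csur : set (cfun X Y) := [set f | set_surj [set: X] [set: Y] f].

Definition ciso : set (cfun X Y) := [set f | set_bij [set: X] [set: Y] f].

End surjective_and_bijective_maps.

Arguments csur : clear implicits.
Arguments ciso : clear implicits.

Lemma ciso_homeomorphism (X : topologicalType) (Y : uniformType)
    (f : cfun X Y) :
  compact [set: X] -> hausdorff_space Y -> ciso X Y f ->
  exists g : continuousType Y X, cancel f g /\ cancel g f.
Proof.
move=> cX hY [_ finj fsurj].
pose g y := sval (cid2 (fsurj y I)).
have gK : cancel g f by move=> y; rewrite /g; case: cid2.
have fK : cancel f g.
  by move=> x; apply: finj; rewrite ?inE// gK.
suff cg : continuous g by exists (mkcts cg).
apply/continuous_closedP => A cA.
have -> : g @^-1` A = f @` A.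
  by apply/seteqP; split=> [y Agy|_ [x Ax <-]]; [exists (g y)|rewrite /= fK].
apply: (compact_closed hY); apply: continuous_compact.
  by apply: continuous_subspaceT; exact: (@cts_fun _ _ (f : continuousType X Y)).
exact: subclosed_compact cA cX _.
Qed.

(* Main.v *)
(** Density: split [Y] into clopen pieces of small diameter. Their preimages
under a surjective [f] are nonempty clopen subsets of [X], and nonempty clopen
subsets of Cantor spaces are Cantor spaces, hence pairwise homeomorphic; gluing
homeomorphisms of the preimages onto the pieces gives a homeomorphism close to
[f].

Descriptive complexity: for a metric [d] on [X], the bijections are the
surjections all of whose fibers have [d]-diameter below [1/n] for every [n];
compactness of [X * X] makes this condition open in [f], while surjectivity is
closed, hence Gdelta. *)

Require Import Defs.
From HB Require Import structures.
From mathcomp Require Import all_boot all_order all_algebra finmap.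
From mathcomp Require Import all_classical all_reals all_analysis.
From mathcomp Require Import borel_hierarchy lra.
Set Implicit Arguments.
Unset Strict Implicit.
Import Order.TTheory GRing.Theory Num.Theory.
Import numFieldTopology.Exports.
Local Open Scope classical_set_scope.
Local Open Scope ring_scope.

(** * Metrizable topologies and the coding by the Cantor space *)

Lemma induces_nbhsP (R : realType) (T : topologicalType) (d : T -> T -> R) :
  induces_topology d -> forall x P,
  nbhs x P <-> exists2 e : R, 0 < e & forall y, d x y < e -> P y.
Proof. by move=> dT x P; rewrite dT; split=> -[e e0 eP]; exists e. Qed.

(** This puts [T] in the form expected by [homeomorphism_cantor_like]. The metric structure is
    packed over the given topology, so that topological facts transfer along the equality without
    change; [t0] supplies the base point. *)
Lemma metrizable_pseudoPMetric (R : realType) (T : topologicalType) (t0 : T) :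
  metrizable R T -> exists M : pseudoPMetricType R, (M : topologicalType) = T.
Proof.
move=> [d [[d_ge0 d_eq0 d_sym d_tri] /induces_nbhsP dT]].
case: T => T cT in t0 d d_ge0 d_eq0 d_sym d_tri dT *.
pose TT : topologicalType := Topological.Pack cT.
pose ball (x : TT) (e : R) (y : TT) := d x y < e.
have bc x (e : R) : 0 < e -> ball x e x by rewrite /ball (d_eq0 x x).2.
have bs x y (e : R) : ball x e y -> ball y e x by rewrite /ball d_sym.
have bt x y z (e1 e2 : R) : ball x e1 y -> ball y e2 z -> ball x (e1 + e2) z.
  by rewrite /ball => xy yz; apply: le_lt_trans (d_tri x y z) _; exact: ltrD.
pose ent : set_system (TT * TT) := entourage_ ball.
have ent_filter : Filter ent.
  apply: filter_from_filter; first by exists 1; exact: ltr01.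
  move=> e1 e2 /= e10 e20; exists (Num.min e1 e2).
    by rewrite /= lt_min e10.
  by move=> [x y] /=; rewrite /ball lt_min => /andP[].
have ent_diag A : ent A -> diagonal `<=` A.
  by move=> [e e0 eA] [x y] /diagonalP <-; apply: eA; exact: bc.
have ent_inv A : ent A -> ent (A^-1)%relation.
  by move=> [e e0 eA]; exists e => // -[x y] /= /bs yx; exact: eA.
have ent_split A : ent A -> exists2 B, ent B & (B \; B `<=` A)%relation.
  move=> [e e0 eA]; exists [set xy | ball xy.1 (e / 2) xy.2].
    by exists (e / 2) => //=; rewrite divr_gt0.
  move=> [x z] [y /= xy yz]; apply: eA => /=; rewrite [e]splitr; exact: bt yz.
have nbhsE : nbhs = nbhs_ ent.
  apply/funext => x; apply/seteqP; split=> P.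
    move=> /dT[e e0 eP]; exists [set xy | ball xy.1 e xy.2]; first by exists e.
    by move=> y /xsectionP /eP.
  move=> [A [e e0 eA] AP]; apply/dT; exists e => // y xy; apply: AP.
  by apply/xsectionP; exact: eA.
pose mU := Nbhs_isUniform_mixin.Build TT
  ent_filter ent_diag ent_inv ent_split nbhsE.
pose U : uniformType := HB.pack TT mU.
pose mP := Uniform_isPseudoMetric.Build R U bc bs bt erefl.
pose mPt := isPointed.Build TT t0.
pose M : pseudoPMetricType R := HB.pack TT mU mP mPt.
by exists M.
Qed.

Lemma cantor_coding (R : realType) (T : topologicalType) (t0 : T) :
  metrizable R T -> cantor_like T ->
  exists (F : cantor_space -> T) (G : T -> cantor_space),
    [/\ continuous F, continuous G, cancel F G & cancel G F].
Proof.
move=> /(metrizable_pseudoPMetric t0)[M <-].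
move=> /(@homeomorphism_cantor_like R)[F [cF clF]].
have FK : cancel F F^-1 by move=> x; rewrite funK ?inE.
have KF : cancel F^-1 F by move=> x; rewrite invK ?inE.
exists F, F^-1%FUN; split=> //.
(* The inverse is continuous because [F] is a closed map: the preimage of [A] under the inverse is
   the image of [A] under [F]. *)
apply/continuous_closedP => A /clF; congr closed.
apply/seteqP; split=> [_ [x Ax <-]|y Ay].
  by rewrite /= FK.
by exists (F^-1%FUN y).
Qed.

(** * Nonempty clopen subsets are Cantor spaces *)

Section clopen_subspace.
Context {R : realType} {T : topologicalType} (U : set T).

Lemma metrizable_subspace : metrizable R T -> metrizable R U.
Proof.
move=> [d [[d_ge0 d_eq0 d_sym d_tri] /induces_nbhsP dT]].
exists (fun x y => d (set_val x) (set_val y)); split.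
  split=> // x y; split=> [/d_eq0|->]; last exact/d_eq0.
  exact: val_inj.
move=> x; apply/seteqP; split=> P.
  move=> [_ [[W oW <-] /= Wx WP]].
  have /dT[e e0 eW] : nbhs (set_val x) W by exact: open_nbhs_nbhs.
  by exists e => // y xy; apply: WP; exact: eW.
move=> [e e0 eP].
have : nbhs (set_val x) [set z | d (set_val x) z < e] by apply/dT; exists e.
move/(@initial_continuous U T set_val x) => /(@filterS _ (nbhs x)); apply.
by move=> y; exact: eP.
Qed.

Lemma is_cantor_subspace :
  is_cantor R T -> clopen U -> U !=set0 -> is_cantor R U.
Proof.
move=> [_ cT mT bT iT] [oU cU] [u Uu]; split.
- by exists (SigSub (mem_set Uu)).
- pose u' : set_type U := SigSub (mem_set Uu).
  (* The identity of [U], extended by the junk value [u'] outside [U], maps the compact set [U] onto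
     the whole subtype, which is therefore compact. *)
  have cid : {within U, continuous (@valL_ T (set_type U) u' U id)}.
    by apply/subspace_valL_continuousP' => x; exact: cvg_id.
  have /(continuous_compact cid) : compact U.
    exact: subclosed_compact cU cT _.
  congr compact; apply/seteqP; split=> // x _.
  exists (set_val x); first exact: set_valP.
  by have /(congr1 (@^~ x)) := @valLK T (set_type U) u' U id.
- exact: metrizable_subspace.
- split; first by move=> A [].
  move=> x P [_ [[W oW <-] /= Wx WP]].
  have [_ bTx] := bT; have /bTx[B [cB Bx] BW] : nbhs (set_val x) W.
    exact: open_nbhs_nbhs.
  exists (set_val @^-1` B) => [|z /BW/WP//].
  split => //; apply: preimage_clopen => //; exact: initial_continuous.
- apply/seteqP; split=> // x [_ [V]].
  rewrite setIT => -[_ [[W oW <-] /= Wx WV] VE].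
  (* Since [U] is open, a point that [W] isolates within [U] is isolated in [T] by the neighbourhood
     [U]&[W]. *)
  suff : isolated [set: T] (set_val x) by rewrite iT.
  split; first by rewrite inE.
  exists (U `&` W).
    apply: open_nbhs_nbhs; split; [exact: openI|split=> //; exact: set_valP].
  rewrite setIT; apply/seteqP; split=> [z [Uz Wz]|_ ->]; last first.
    by split=> //; exact: set_valP.
  have : V (SigSub (mem_set Uz)) by exact: WV.
  by rewrite VE => <-.
Qed.

End clopen_subspace.

(** * Any two Cantor spaces are homeomorphic *)

Section is_cantor.
Context {R : realType} {T : topologicalType}.
Hypothesis cT : is_cantor R T.

(** A clopen neighbourhood of [x] inside the ball of radius [d x y] around [x] cannot contain
    [y]. *)
Lemma is_cantor_zero_dimensional : zero_dimensional T.
Proof.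
have [_ _ [d [[d_ge0 d_eq0 _ _] /induces_nbhsP dT]] [_ bT] _] := cT.
move=> x y xy; have /bT[U [cU Ux] UB] : nbhs x [set z | d x z < d x y].
  apply/dT; exists (d x y) => //; rewrite lt_def d_ge0 andbT.
  by apply: contra_neqN xy => /eqP/d_eq0.
by exists U; split=> // /UB /=; rewrite ltxx.
Qed.

Lemma is_cantor_hausdorff : hausdorff_space T.
Proof.
rewrite open_hausdorff => x y /is_cantor_zero_dimensional[U [[oU cU] Ux Uy]].
exists (U, ~` U); rewrite /= ?inE//; split=> //; first exact: closed_openC.
by rewrite setICr.
Qed.

Lemma is_cantor_like : cantor_like T.
Proof.
have [_ kT _ _ iT] := cT; split=> //.
- apply/perfectP; by split=> //; exact: closedT.
- exact: is_cantor_hausdorff.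
- exact: is_cantor_zero_dimensional.
Qed.

End is_cantor.

Lemma is_cantor_homeo (R : realType) (X Y : topologicalType) :
  is_cantor R X -> is_cantor R Y ->
  exists h : X -> Y, continuous h /\ bijective h.
Proof.
move=> cX cY; have [[x0 _] _ mX _ _] := cX; have [[y0 _] _ mY _ _] := cY.
have [F [F' [cF cF' FK F'K]]] := cantor_coding x0 mX (is_cantor_like cX).
have [G [G' [cG cG' GK G'K]]] := cantor_coding y0 mY (is_cantor_like cY).
exists (G \o F'); split; last by apply: bij_comp; [exists G'|exists F].
by move=> x; apply: continuous_comp; [exact: cF'|exact: cG].
Qed.

(** The map is total on [X], with the junk value [v] off [U], so that such maps can later be glued.
    As [U] is open, continuity within [U] amounts to continuity at each point of [U]. *)
Lemma clopen_homeo (R : realType) (X Y : topologicalType)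
    (U : set X) (V : set Y) :
  is_cantor R X -> is_cantor R Y ->
  clopen U -> U !=set0 -> clopen V -> V !=set0 ->
  exists h : X -> Y, {in U, continuous h} /\ set_bij U V h.
Proof.
move=> cX cY clU U0 clV V0; have [v Vv] := V0.
have [h [ch bh]] := is_cantor_homeo (is_cantor_subspace cX clU U0)
  (is_cantor_subspace cY clV V0).
pose k : U -> Y := set_val \o h.
exists ('valL_v k); split; last first.
  apply/valL_bijP; split=> [x _|x y _ _|y Vy].
  - exact: set_valP.
  - by move=> kxy; apply: (bij_inj bh); exact: val_inj.
  - have [h' _ h'K] := bh; exists (h' (SigSub (mem_set Vy))) => //.
    by rewrite /k /= h'K.
have : {within U, continuous 'valL_v k}.
  apply/subspace_valL_continuousP' => x.
  apply: continuous_comp; first exact: ch.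
  exact: initial_continuous.
by rewrite continuous_open_subspace//; case: clU.
Qed.

(** * Approximating a surjection by homeomorphisms *)

Lemma clopen_fiber (T : topologicalType) (I : Type) (c : T -> I) (i : I) :
  (forall x, \forall z \near x, c z = c x) -> clopen [set x | c x = i].
Proof.
move=> cloc; split; last rewrite -openC.
- by rewrite openE => x /= <-; exact: cloc.
- by rewrite openE => x /= ci; apply: filterS (cloc x) => z /= ->.
Qed.

(** A point is labelled by the set of members containing it in a finite clopen cover by subsets of
    balls of radius [e / 2]. Membership in each of finitely many clopen sets is locally constant,
    hence so is the label; two points with the same label share a member of the cover. *)
Lemma small_fiber_labelling (R : realType) (Y : metricType R) (e : R) :
  compact [set: Y] -> basis (@clopen Y) -> 0 < e ->
  exists c : Y -> set Y, (forall y, \forall z \near y, c z = c y) /\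
    forall y z, c y = c z -> mdist y z < e.
Proof.
move=> kY [_ bY] e0.
have Bex (y : Y) : exists B, [/\ clopen B, B y & B `<=` ball y (e / 2)].
  have /(bY y)[B [cB By] Be] : nbhs y (ball y (e / 2)).
    by apply: nbhsx_ballx; rewrite divr_gt0.
  by exists B.
have [B BP] := choice Bex.
have [[y0 _]|nY] := pselect ([set: Y] !=set0); last first.
  by exists (fun=> set0); split=> y; exfalso; apply: nY; exists y.
pose Y0 : ptopologicalType :=
  HB.pack (Y : topologicalType) (isPointed.Build Y y0).
have : @compact Y0 [set: Y] by [].
rewrite compact_cover => /(_ Y [set: Y] B)[||D _ YD].
- by move=> y _; have [[]] := BP y.
- by move=> y _; exists y => //; have [] := BP y.
exists (fun y => [set i | [set` D] i /\ B i y]); split=> [y|y z yz].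
  have : \forall z \near y,
      (\bigcap_(i in [set` D]) [set z | B i z <-> B i y]) z.
    apply: filter_bigI => i _; have [[oB cB] _ _] := BP i.
    have [Bi|nBi] := pselect (B i y).
      by apply: filterS (open_nbhs_nbhs (conj oB Bi)) => z Bz; split.
    apply: filterS (open_nbhs_nbhs (conj (closed_openC cB) nBi)) => z Bz.
    by split.
  apply: filterS => z zP; apply/seteqP; split=> i /= [iD Bi]; split=> //;
    exact/(zP i iD).
have [i /= iD Biy] := YD y I.
have [_ Biz] : [set i | [set` D] i /\ B i z] i by rewrite -yz.
have [_ _ Bie] := BP i.
move: Biy Biz => /Bie + /Bie; rewrite !ballEmdist /= => iy iz.
apply: le_lt_trans (metric_triangle _ i _) _.
by rewrite [e]splitr ltrD// metric_sym.
Qed.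

Lemma csur_approx (R : realType) (X : topologicalType) (Y : metricType R)
    (f : cfun X Y) (e : R) :
  is_cantor R X -> is_cantor R Y -> csur X Y f -> 0 < e ->
  exists2 g, ciso X Y g & forall x, mdist (f x) (g x) < e.
Proof.
move=> cX cY fsur e0; have [_ kY _ bY _] := cY.
have [c [cloc csmall]] := small_fiber_labelling kY bY e0.
pose U k := [set x | c (f x) = k]; pose V k := [set z | c z = k].
have hex k : exists h : X -> Y,
    V k !=set0 -> {in U k, continuous h} /\ set_bij (U k) (V k) h.
  (* For a label that is not attained, [f] serves as a dummy value. *)
  have [[y Vy]|nV] := pselect (V k !=set0); last by exists f.
  have clV : clopen (V k) by exact: clopen_fiber.
  have clU : clopen (U k).
    exact: (preimage_clopen clV (@cfun_continuous _ _ _ f)).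
  have [|h] := clopen_homeo cX cY clU _ clV (ex_intro _ y Vy); last by exists h.
  by have [x _ fxy] := fsur y I; exists x; rewrite /U /= fxy.
have {hex}[h hP] := choice hex.
have {}hP x : {in U (c (f x)), continuous (h (c (f x)))} /\
    set_bij (U (c (f x))) (V (c (f x))) (h (c (f x))).
  by apply: hP; exists (f x).
(* [g] is the gluing of homeomorphisms of the clopen pieces [U k] onto the
   [V k]; it is close to [f] because both map [U k] into the small [V k]. *)
pose g x := h (c (f x)) x.
have cgx x : c (g x) = c (f x).
  by have [_ [hUV _ _]] := hP x; exact: hUV.
have cg : continuous g.
  (* Near [x] the label of [f] is constant, so [g] agrees there with the single map
     [h (c (f x))]. *)
  move=> x; have [+ _] := hP x => /(_ x); rewrite inE => /(_ erefl) hx.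
  apply: cvg_trans hx; apply: near_eq_cvg.
  have : \forall x' \near x, c (f x') = c (f x).
    exact: (@cfun_continuous _ _ _ f x _ (cloc (f x))).
  by apply: filterS => x' /= cE; rewrite /g cE.
exists ((mkcts cg : continuousType X Y) : cfun X Y) => [|x]; last first.
  by apply: csmall; rewrite -cgx.
suff : set_bij [set: X] [set: Y] g by [].
split=> [//|x x' _ _ gxx'|y _].
  (* Equal values of [g] have equal labels, which puts [x] and [x'] in the same piece, where one
     injective [h] applies. *)
  have cE : c (f x') = c (f x) by rewrite -!cgx gxx'.
  have [_ [_ hinj _]] := hP x.
  by apply: hinj; rewrite ?inE// [LHS]gxx' /g cE.
have [x0 _ fx0] := fsur y I; have [_ [_ _ hsur]] := hP x0.
have [|x Ux hx] := hsur y; first by rewrite fx0.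
by exists x => //; rewrite /= /g Ux.
Qed.

(** * Stability properties of Gdelta sets *)

(** A closed set is the intersection of its open neighbourhoods of radius [n.+1%:R^-1]. *)
Lemma closed_Gdelta (R : realType) (T : topologicalType) (C : set T) :
  metrizable R T -> closed C -> Gdelta C.
Proof.
move=> [d [[_ d_eq0 d_sym d_tri] /induces_nbhsP dT]] cC.
exists (fun n => [set y | exists2 x, C x & d x y < n.+1%:R^-1]).
  move=> n; rewrite openE => y [x Cx xy]; apply/dT.
  exists (n.+1%:R^-1 - d x y) => [|z yz]; first by rewrite subr_gt0.
  by exists x => //; apply: le_lt_trans (d_tri x y z) _; rewrite addrC -ltrBrDr.
apply/seteqP; split=> [x Cx n _|y yC].
  by exists x => //; rewrite (d_eq0 x x).2.
apply: cC => P /dT[e e0 eP].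
have [n ne] := filter_ex (near_infty_natSinv_lt (PosNum e0)).
have [x Cx xy] := yC n I; exists x; split=> //; apply: eP.
by rewrite d_sym; exact: lt_trans ne.
Qed.

Lemma GdeltaI (T : topologicalType) (A B : set T) :
  Gdelta A -> Gdelta B -> Gdelta (A `&` B).
Proof.
move=> [F oF ->] [G oG ->]; exists (fun n => F n `&` G n) => [n|].
  exact: openI.
by rewrite bigcapI.
Qed.

Lemma Gdelta_preimage (S T : topologicalType) (f : S -> T) (A : set T) :
  continuous f -> Gdelta A -> Gdelta (f @^-1` A).
Proof.
move=> cf [F oF ->]; exists (fun n => f @^-1` F n) => [n|].
  by apply: open_comp => // x _; exact: cf.
by rewrite preimage_bigcap.
Qed.

(** * The sup metric: completeness, surjections and bijections *)

Section spaces_of_maps.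
Context {R : realType} {X : topologicalType} {Y : metricType R}.
Hypotheses (X0 : [set: X] !=set0) (kX : compact [set: X]).

Let supdistP := induces_nbhsP (@supdist_induces R X Y X0 kX).

(** Compactness of [Y] gives a cluster point [l x] of each sequence [u n x]; the uniform Cauchy
    condition then makes [l] a uniform limit, hence continuous. *)
Lemma supdist_complete : compact [set: Y] -> complete_for (@supdist R X Y).
Proof.
move=> kY u uC.
have lex x : exists l : Y, cluster ((fun n => u n x) @ \oo) l.
  have [|l [_ ?]] := kY ((fun n => u n x) @ \oo) _; first exact: filterT.
  by exists l.
have [l lP] := choice lex.
have ul e : 0 < e ->
    exists N, forall n x, (N <= n)%N -> mdist (u n x) (l x) < e.
  move=> e0; have e20 : 0 < e / 2 by rewrite divr_gt0.
  have [N uN] := uC _ e20; exists N => n x Nn.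
  (* Clustering provides an index [m] past [N], depending on [x], with [u m x] close to [l x]; the
     bound [N] itself does not depend on [x]. *)
  have [_ [[m Nm <-]]] :
      [set u m x | m in [set m | (N <= m)%N]] `&` ball (l x) (e / 2) !=set0.
    by apply: (lP x); [exists N => // m Nm; exists m|exact: nbhsx_ballx].
  rewrite ballEmdist /= metric_sym => ml.
  have := uN n m Nn Nm; have := @supdist_ub R X Y X0 kX (u n) (u m) x.
  have := metric_triangle (u n x) (u m x) (l x); lra.
have cl : continuous l.
  move=> x P /nbhs_ballP[e /= e0 eP].
  have e30 : 0 < e / 3 by rewrite divr_gt0.
  have [N uN] := ul _ e30.
  have : nbhs x (u N @^-1` ball (u N x) (e / 3)).
    by apply: (@cfun_continuous _ _ _ (u N)); exact: nbhsx_ballx.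
  apply: filterS => y; rewrite /= ballEmdist /= => uxy; apply: eP.
  rewrite ballEmdist /=.
  have := uN N x (leqnn N); have := uN N y (leqnn N).
  have := metric_triangle (l x) (u N x) (l y).
  have := metric_triangle (u N x) (u N y) (l y).
  rewrite (metric_sym (l x) (u N x)); lra.
exists ((mkcts cl : continuousType X Y) : cfun X Y) => P /supdistP[e e0 eP].
(* Strict pointwise bounds give only a weak bound on the supremum, hence [e / 2]. *)
have [|N uN] := ul (e / 2); first by rewrite divr_gt0.
exists N => // n Nn; apply: eP; apply: (@le_lt_trans _ _ (e / 2)); last lra.
by apply: (supdist_le X0 kX) => x; rewrite metric_sym ltW// uN.
Qed.

(** Surjections [g] arbitrarily close to [f] put every [y] in the closure of the range of [f], which
    is compact and thus closed. *)
Lemma closed_csur : compact [set: Y] -> closed (csur X Y).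
Proof.
move=> kY f fC y _.
have kfX : compact (range f).
  apply: continuous_compact => //; apply: continuous_subspaceT.
  exact: (@cfun_continuous _ _ _ f).
apply: (compact_closed (@metric_hausdorff R Y) kfX).
move=> P /nbhs_ballP[e /= e0 eP].
have [|g [gsur fg]] := fC [set g | supdist f g < e].
  by apply/supdistP; exists e.
have [x _ gxy] := gsur y I; exists (f x); split; first by exists x.
apply: eP; rewrite ballEmdist /= -gxy metric_sym.
by apply: le_lt_trans fg; exact: supdist_ub.
Qed.

(** Compactness of the square of [X] yields one [r > 0] such that points whose images under [f] are
    within [r] are at distance below [e]. If [g] is within [r / 2] of [f], points identified by [g]
    have images under [f] within [r]. *)
Lemma open_fiber_diam (d : X -> X -> R) (e : R) :
  is_metric d -> induces_topology d ->
  open [set f : cfun X Y | forall x x', f x = f x' -> d x x' < e].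
Proof.
move=> [_ d_eq0 d_sym d_tri] /induces_nbhsP dX; rewrite openE => f fe.
have : \forall r \near 0^'+, [set: X * X] `<=`
    (fun p => mdist (f p.1) (f p.2) < r -> d p.1 p.2 < e).
  have kXX : compact [set: X * X] by rewrite -setXTT; exact: compact_setX.
  apply: (iffLR (compact_near_coveringP _) kXX) => -[x x'] _.
  have dnear z r : 0 < r -> \forall z' \near z, d z z' < r.
    by move=> r0; apply/dX; exists r.
  have fnear z r : 0 < r -> \forall z' \near z, mdist (f z) (f z') < r.
    move=> r0; have := @cfun_continuous _ _ _ f z _ (nbhsx_ballx (f z) r r0).
    by rewrite ballEmdist.
  have nfst (P : set X) : nbhs x P -> \forall p \near (x, x'), P p.1.
    by move=> xP; exists (P, setT); [split=> //; exact: filterT|case=> ? ? []].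
  have nsnd (P : set X) : nbhs x' P -> \forall p \near (x, x'), P p.2.
    by move=> xP; exists (setT, P); [split=> //; exact: filterT|case=> ? ? []].
  (* If [d x x' < e], the inequality persists near the pair, the slack being shared by the two
     coordinates. *)
  have [dxx'|dxx'] := ltP (d x x') e.
    have r0 : 0 < (e - d x x') / 2 by rewrite divr_gt0// subr_gt0.
    have d1 := nfst _ (dnear x _ r0).
    have d2 := nsnd _ (dnear x' _ r0).
    near=> p r => /= _.
    have : d x p.1 < (e - d x x') / 2 by near: p.
    have : d x' p.2 < (e - d x x') / 2 by near: p.
    have := d_tri p.1 x p.2; have := d_tri x x' p.2; rewrite (d_sym p.1 x); lra.
  (* Otherwise [f] separates [x] from [x']. Moving both points costs less than two thirds of the
     gap, which leaves more than [r]. *)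
  have r0 : 0 < mdist (f x) (f x') / 3.
    rewrite divr_gt0// mdist_gt0; apply: contraPneq dxx' => /fe.
    by rewrite ltNge => /negP.
  have d1 := nfst _ (fnear x _ r0).
  have d2 := nsnd _ (fnear x' _ r0).
  near=> p r => /=.
  have : r < mdist (f x) (f x') / 3 by near: r; exact: nbhs_right_lt.
  have : mdist (f x) (f p.1) < mdist (f x) (f x') / 3 by near: p.
  have : mdist (f x') (f p.2) < mdist (f x) (f x') / 3 by near: p.
  have := metric_triangle (f x) (f p.1) (f x').
  have := metric_triangle (f p.1) (f p.2) (f x').
  rewrite (metric_sym (f p.2)); lra.
move=> rP.
have [r [/= r0 rfe]] := filter_ex (filterI (nbhs_right_gt (0 : R)) rP).
apply/supdistP; exists (r / 2) => [|g fg x x' gxx']; first by rewrite divr_gt0.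
apply: (rfe (x, x') I) => /=.
have := @supdist_ub R X Y X0 kX f g x; have := @supdist_ub R X Y X0 kX f g x'.
have := metric_triangle (f x) (g x) (f x').
rewrite gxx' (metric_sym (g x')); lra.
Unshelve. all: by end_near. Qed.

Lemma ciso_Gdelta : metrizable R X -> compact [set: Y] -> Gdelta (ciso X Y).
Proof.
move=> [d [dm dX]] kY; have [d_ge0 d_eq0 d_sym _] := dm.
have -> : ciso X Y = csur X Y `&`
    \bigcap_n [set f | forall x x', f x = f x' -> d x x' < n.+1%:R^-1].
  apply/seteqP; split=> [f [_ finj fsur]|f [fsur fd]].
    split=> // n _ x x' /finj; rewrite !inE => /(_ I I) ->.
    by rewrite (d_eq0 x' x').2.
  split=> // x x' _ _ fxx'; apply/d_eq0/eqP; rewrite eq_le d_ge0 andbT.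
  apply/ler_addgt0Pl => e e0; rewrite addr0.
  have [n ne] := filter_ex (near_infty_natSinv_lt (PosNum e0)).
  by apply: le_trans (ltW ne); apply/ltW/fd.
apply: GdeltaI; last first.
  by eexists; [|reflexivity] => n; exact: (open_fiber_diam _ dm dX).
apply: closed_Gdelta; last exact: closed_csur.
exists (@supdist R X Y).
by split; [exact: supdist_is_metric|exact: supdist_induces].
Qed.

End spaces_of_maps.

Unset Implicit Arguments.

(** * Density and residuality of the homeomorphisms *)

Theorem theorem2p5 (R : realType) (X : topologicalType) (Y : metricType R) :
  is_cantor R X -> is_cantor R Y ->
  [/\ completely_metrizable R (cfun X Y),
      Gdelta (ciso X Y),
      closed (csur X Y),
      dense (set_val @^-1` ciso X Y : set (csur X Y)) &
      residual (set_val @^-1` ciso X Y : set (csur X Y))].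
Proof.
move=> cX cY; have [X0 kX mX _ _] := cX; have [_ kY _ _ _] := cY.
have GI : Gdelta (ciso X Y) by exact: ciso_Gdelta.
have DI : dense (set_val @^-1` ciso X Y : set (csur X Y)).
  (* A relatively open [O] is the trace of an open [W] in the full space of maps, and [W] contains a
     sup-metric ball around [f]. *)
  move=> O [f Of] [W oW WO].
  have /(induces_nbhsP (supdist_induces X0 kX))[e e0 eW] : nbhs (set_val f) W.
    by apply: open_nbhs_nbhs; split=> //; move: Of; rewrite -WO.
  have [|g gI fg] := csur_approx cX cY (set_valP f) (_ : 0 < e / 2).
    by rewrite divr_gt0.
  have gS : csur X Y g by have [_ _] := gI.
  exists (SigSub (mem_set gS)); split=> //; rewrite -WO; apply: eW.
  apply: (@le_lt_trans _ _ (e / 2)); last by lra.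
  by apply: supdist_le => // x; exact/ltW/fg.
split=> //.
- exists (@supdist R X Y); split; first exact: supdist_is_metric.
    exact: supdist_induces.
  exact: supdist_complete.
- exact: closed_csur.
(* The set is its own dense Gdelta witness: the Gdelta property passes to the subspace by preimage
   under the inclusion. *)
- exists (set_val @^-1` ciso X Y); split=> //.
  by apply: Gdelta_preimage => //; exact: initial_continuous.
Qed.
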